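(* Let $\mathfrak{X}$ be a saturated fusion action system of a finite $p$-group $S$ on a finite set $X$, and let $C=\{s\in S:\ell_s=\mathrm{id}_X\}$ be the core of the action. Let $\mathcal{C}$ be the core fusion system associated to $\mathfrak{X}$, i.e. the fusion system on $C$ with $\mathcal{C}(P,Q)=\{\varphi\in\mathrm{Inj}(P,Q):(\varphi,\mathrm{id}_X)\in\mathfrak{X}(P,Q)\}$ for $P,Q\le C$. Then $\mathcal{C}$ is a saturated fusion system.
   Context: Let $p$ be a prime, $S$ a finite $p$-group, and $X$ a finite set with a left $S$-action; $\Sigma_X$ is the symmetric group on $X$, $\ell_s\in\Sigma_X$ is the permutation $x\mapsto s\cdot x$, and $c_s$ is conjugation $h\mapsto shs^{-1}$. $\mathrm{Inj}(P,Q)$ is the set of injective homomorphisms $P\to Q$. A pair $(\varphi,\sigma)\in\mathrm{Inj}(P,Q)\times\Sigma_X$ ($P,Q\le S$) is intertwined if $\sigma\ell_p\sigma^{-1}=\ell_{\varphi(p)}$ for all $p\in P$. Let $\mathfrak{U}$ be the category whose objects are all subgroups of $S$, whose morphisms $P\to Q$ are the intertwined pairs, composed componentwise. Let $\mathfrak{X}_S\subseteq\mathfrak{U}$ have the same objects and morphisms $P\to Q$ the pairs $(c_s|_P,\ell_s)$ with $s\in S$, $sPs^{-1}\le Q$. A fusion action system of $S$ on $X$ is a category $\mathfrak{X}$ with $\mathfrak{X}_S\subseteq\mathfrak{X}\subseteq\mathfrak{U}$ such that every morphism of $\mathfrak{X}$ factors as an isomorphism of $\mathfrak{X}$ followed by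 an inclusion $(\mathrm{incl},\mathrm{id}_X)$. Write $\mathfrak{X}(P)=\mathfrak{X}(P,P)$ and $\mathfrak{X}(P,Q)_{\mathrm{iso}}$ for the isomorphisms. The underlying fusion system $\mathcal{F}^{\mathfrak{X}}$ has the subgroups of $S$ as objects and $\mathcal{F}^{\mathfrak{X}}(P,Q)=\{\varphi : \exists\sigma,\ (\varphi,\sigma)\in\mathfrak{X}(P,Q)\}$; two subgroups are conjugate if they are isomorphic in $\mathcal{F}^{\mathfrak{X}}$. Let $N_S(P;X)=N_S(P)\cap C$, $Z_S(P;X)=Z_S(P)\cap C$. A subgroup $P\le S$ is fully normalized (resp. fully centralized, fully $X$-normalized, fully $X$-centralized) if $|N_S(P)|\ge|N_S(Q)|$ (resp. the same inequality for $Z_S(-)$, $N_S(-;X)$, $Z_S(-;X)$) for all $Q$ conjugate to $P$. Put $\mathrm{Aut}_S(P)=\{c_s|_P:s\in N_S(P)\}$, $\mathrm{Aut}_S(P;X)=\{(c_s|_P,\ell_s):s\in N_S(P)\}$, $\Sigma_{\mathfrak{X}}(P)=\{\sigma:\exists\varphi,(\varphi,\sigma)\in\mathfrak{X}(P)\}$, $\Sigma^S_{\mathfrak{X}}(P)=\{\ell_s:s\in N_S(P)\}$, $\mathcal{F}^{\mathfrak{X}}(P)_0=\{\varphi:(\varphi,\mathrm{id}_X)\in\mathfrak{X}(P)\}$, $\mathcal{F}_S(P)_0=\{c_s|_P:s\in N_S(P;X)\}$, $\Sigma_{\mathfrak{X}}(P)_0=\{\sigma:(\mathrm{id}_P,\sigma)\in\mathfrak{X}(P)\}$,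 $\Sigma^S_{\mathfrak{X}}(P)_0=\{\ell_s:s\in Z_S(P)\}$. The extender of $(\varphi,\sigma)\in\mathfrak{X}(P,Q)_{\mathrm{iso}}$ is $N_{(\varphi,\sigma)}=\{n\in N_S(P):(\varphi c_n\varphi^{-1},\sigma\ell_n\sigma^{-1})\in\mathrm{Aut}_S(Q;X)\}$. $\mathfrak{X}$ is saturated if: (1) for every $P\le S$, fully normalized implies fully $X$-normalized and fully centralized, and each of fully $X$-normalized and fully centralized implies fully $X$-centralized; (2) if $P$ is fully normalized then $\mathrm{Aut}_S(P)\in\mathrm{Syl}_p(\mathcal{F}^{\mathfrak{X}}(P))$, $\mathrm{Aut}_S(P;X)\in\mathrm{Syl}_p(\mathfrak{X}(P))$ and $\Sigma^S_{\mathfrak{X}}(P)\in\mathrm{Syl}_p(\Sigma_{\mathfrak{X}}(P))$; (3) if $P$ is fully $X$-normalized then $\mathcal{F}_S(P)_0\in\mathrm{Syl}_p(\mathcal{F}^{\mathfrak{X}}(P)_0)$; (4) if $P$ is fully centralized then $\Sigma^S_{\mathfrak{X}}(P)_0\in\mathrm{Syl}_p(\Sigma_{\mathfrak{X}}(P)_0)$; (5) if $Q$ is fully $X$-centralized and $(\varphi,\sigma)\in\mathfrak{X}(P,Q)_{\mathrm{iso}}$, there is $(\widetilde\varphi,\sigma)\in\mathfrak{X}(N_{(\varphi,\sigma)},S)$ with $\widetilde\varphi|_P=\varphi$. A fusion system $\mathcal{F}$ on a finite $p$-group $T$ is a category whose objects are all subgroups of $T$, with $\mathcal{F}(P,Q)\subseteq\mathrm{Inj}(P,Q)$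 containing all $c_t|_P$ for $t\in T$, $tPt^{-1}\le Q$, and such that every morphism factors as an isomorphism of $\mathcal F$ followed by an inclusion. $P\le T$ is fully normalized (centralized) in $\mathcal{F}$ if $|N_T(P)|\ge|N_T(Q)|$ (resp. $|Z_T(P)|\ge|Z_T(Q)|$) for all $Q$ isomorphic to $P$ in $\mathcal{F}$. For an isomorphism $\varphi\in\mathcal{F}(P,Q)$ put $N_\varphi=\{n\in N_T(P):\varphi c_n\varphi^{-1}\in\mathrm{Aut}_T(Q)\}$. $\mathcal{F}$ is saturated if every fully normalized $P$ is fully centralized and has $\mathrm{Aut}_T(P)\in\mathrm{Syl}_p(\mathcal{F}(P))$, and if for every fully centralized $Q$ and isomorphism $\varphi\in\mathcal{F}(P,Q)$ there is $\widetilde\varphi\in\mathcal{F}(N_\varphi,T)$ with $\widetilde\varphi|_P=\varphi$. *)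

(* Defs.v *)
From HB Require Import structures.
From mathcomp Require Import all_boot all_fingroup all_solvable.

Set Implicit Arguments.
Unset Strict Implicit.
Unset Printing Implicit Defensive.

Import GroupScope.

(** Conventions.
    - A map defined on a subgroup [P] of [gT] is represented by the finite
      function [gT -> gT] that takes the value [1] outside [P]; equality of such
      maps is then Leibniz equality, and the composite of two homomorphisms is
      again of this form.
    - MathComp composes permutations from left to right: the classical
      [sigma \o tau] is [tau * sigma], and the classical [sigma tau sigma^-1] is
      [sigma^-1 * tau * sigma], that is [tau ^ sigma].  Likewise the classical
      conjugate [s h s^-1] is [h ^ s^-1], and [s P s^-1] is [P :^ s^-1].
    - A set of automorphisms of [P] that is a group under classical composition
      is also one under the MathComp product, which is the opposite law; the
      Sylow subgroups are the same.
    - A system of hom-sets is a function of arbitrary pairs of groups, but it is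
      only ever constrained or used on subgroups of the relevant [p]-group. *)

Section Homomorphisms.

Variable gT : finGroupType.
Implicit Types (P Q : {group gT}) (f g : {ffun gT -> gT}).

Definition restr (P : {set gT}) (f : gT -> gT) : {ffun gT -> gT} :=
  [ffun x => if x \in P then f x else 1].

(** The identity of [P], and also the inclusion of [P] into any overgroup. *)
Definition incl (P : {set gT}) : {ffun gT -> gT} := restr P id.

Definition fcomp g f : {ffun gT -> gT} := [ffun x => g (f x)].

Definition conjl (s : gT) : gT -> gT := fun h => s * h * s^-1.

Definition Inj P Q : {set {ffun gT -> gT}} :=
  [set f : {ffun gT -> gT} | [&& f == restr P f, morphic P f, dinjectiveb f P & f @: P \subset Q]].

(** For injective [f] on [P], the inverse of [f : P -> f @: P]. *)
Definition finvl P f : {ffun gT -> gT} :=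
  [ffun y => if [pick x in P | f x == y] is Some x then x else 1].

Definition AutS (T P : {group gT}) : {set {ffun gT -> gT}} :=
  [set restr P (conjl t) | t in 'N_T(P)].

(** A set [E] of automorphisms of [P], as a subset of the group [{perm gT}]:
    an automorphism of [P] is extended by the identity outside [P]
    (see [group_set_autperms] below). *)
Definition autperms P (E : {set {ffun gT -> gT}}) : {set {perm gT}} :=
  [set a : {perm gT} | perm_on P a && (restr P a \in E)].

(** [N] has maximal order on the [conj]-class of [P]. *)
Definition fully (conj : {group gT} -> {group gT} -> Prop)
    (N : {group gT} -> {set gT}) (P : {group gT}) : Prop :=
  forall Q : {group gT}, conj P Q -> #|N Q| <= #|N P|.

End Homomorphisms.

Section FusionSystems.

Variable gT : finGroupType.

Definition hom_family := {group gT} -> {group gT} -> {set {ffun gT -> gT}}.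

Implicit Types (F : hom_family) (T P Q R : {group gT}).

Definition fs_iso F P Q : {set {ffun gT -> gT}} :=
  [set f in F P Q | [exists g in F Q P,
     (fcomp g f == incl P) && (fcomp f g == incl Q)]].

Definition fs_conj T F P Q : Prop :=
  [/\ P \subset T, Q \subset T & fs_iso F P Q != set0].

Record fusion_system (p : nat) T F : Prop := FusionSystem {
  fs_pgroup : p.-group T;
  fs_inj : forall P Q, P \subset T -> Q \subset T -> F P Q \subset Inj P Q;
  fs_conjl : forall P Q t, P \subset T -> Q \subset T ->
    t \in T -> P :^ t^-1 \subset Q -> restr P (conjl t) \in F P Q;
  fs_comp : forall P Q R f g, P \subset T -> Q \subset T -> R \subset T ->
    f \in F P Q -> g \in F Q R -> fcomp g f \in F P R;
  fs_factor : forall P Q f, P \subset T -> Q \subset T -> f \in F P Q ->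
    exists2 R : {group gT}, R \subset Q &
    exists2 g, g \in fs_iso F P R & f = fcomp (incl R) g
}.

Definition fs_fully_normalized T F : {group gT} -> Prop :=
  fully (fs_conj T F) (fun P => 'N_T(P)).

Definition fs_fully_centralized T F : {group gT} -> Prop :=
  fully (fs_conj T F) (fun P => 'C_T(P)).

Definition fs_extender T P Q (f : {ffun gT -> gT}) : {set gT} :=
  [set n in 'N_T(P) |
     fcomp f (fcomp (restr P (conjl n)) (finvl P f)) \in AutS T Q].

(** The extender is a group (see [group_set_fs_extender] below), so that
    [<<_>>] only supplies the group structure. *)
Record saturated_fusion_system (p : nat) T F : Prop := SaturatedFusionSystem {
  sfs_fusion_system : fusion_system p T F;
  sfs_normalized : forall P, P \subset T -> fs_fully_normalized T F P ->
    fs_fully_centralized T F P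
    /\ p.-Sylow(autperms P (F P P)) (autperms P (AutS T P));
  sfs_extension : forall P Q f, P \subset T -> Q \subset T ->
    fs_fully_centralized T F Q -> f \in fs_iso F P Q ->
    exists2 g, g \in F <<fs_extender T P Q f>>%G T & restr P g = f
}.

End FusionSystems.

Section FusionActionSystems.

Variables (gT : finGroupType) (X : finType) (S : {group gT}).

(** Library actions are right actions; the left action of [S] on [X] attached to
    [to] is [s . x = to x s^-1], and every left action of [S] is of this form. *)
Variable to : action S X.

Definition ell (s : gT) : {perm X} := perm (act_inj to s^-1).

Definition action_hom_family :=
  {group gT} -> {group gT} -> {set ({ffun gT -> gT} * {perm X})%type}.

Implicit Types (P Q R : {group gT}) (XX : action_hom_family).
Implicit Types u v : ({ffun gT -> gT} * {perm X})%type.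

Definition acomp v u : ({ffun gT -> gT} * {perm X})%type :=
  (fcomp v.1 u.1, u.2 * v.2).

Definition aincl P : ({ffun gT -> gT} * {perm X})%type := (incl P, 1).

Definition intertwined P u : bool :=
  [forall x in P, ell x ^ u.2 == ell (u.1 x)].

Definition UU P Q : {set ({ffun gT -> gT} * {perm X})%type} :=
  [set u | (u.1 \in Inj P Q) && intertwined P u].

Definition XS P Q : {set ({ffun gT -> gT} * {perm X})%type} :=
  [set (restr P (conjl s), ell s) | s in S & P :^ s^-1 \subset Q].

Definition fas_iso XX P Q : {set ({ffun gT -> gT} * {perm X})%type} :=
  [set u in XX P Q | [exists v in XX Q P,
     (acomp v u == aincl P) && (acomp u v == aincl Q)]].

Record fusion_action_system (p : nat) XX : Prop := FusionActionSystem {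
  fas_pgroup : p.-group S;
  fas_sub : forall P Q, P \subset S -> Q \subset S ->
    (XS P Q \subset XX P Q) /\ (XX P Q \subset UU P Q);
  fas_comp : forall P Q R u v, P \subset S -> Q \subset S -> R \subset S ->
    u \in XX P Q -> v \in XX Q R -> acomp v u \in XX P R;
  fas_factor : forall P Q u, P \subset S -> Q \subset S -> u \in XX P Q ->
    exists2 R : {group gT}, R \subset Q &
    exists2 v, v \in fas_iso XX P R & u = acomp (aincl R) v
}.

Definition underlying XX : hom_family gT := fun P Q =>
  [set f | [exists sigma, (f, sigma) \in XX P Q]].

Definition core_set : {set gT} := [set s in S | ell s == 1].

Lemma ellM : {in S &, forall s t, ell (s * t) = ell t * ell s}.
Proof.
move=> s t Ss St; apply/permP=> x; rewrite permM !permE invMg.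
by rewrite actMin ?groupV.
Qed.

Lemma ell1 : ell 1 = 1.
Proof.
by apply: (mulgI (ell 1)); rewrite -ellM ?group1 // !mulg1.
Qed.

Lemma group_set_core : group_set core_set.
Proof.
apply/group_setP; split=> [|s t].
  by rewrite inE group1 ell1 eqxx.
rewrite !inE => /andP[Ss /eqP es] /andP[St /eqP et].
by rewrite groupM // ellM // es et mulg1 eqxx.
Qed.

Definition core : {group gT} := Group group_set_core.

Definition NSX P : {set gT} := 'N_S(P) :&: core.
Definition ZSX P : {set gT} := 'C_S(P) :&: core.

Section Fully.

Variable XX : action_hom_family.

Let conj := fs_conj S (underlying XX).

Definition fully_normalized := fully conj (fun P => 'N_S(P)).
Definition fully_centralized := fully conj (fun P => 'C_S(P)).
Definition fully_X_normalized := fully conj NSX.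
Definition fully_X_centralized := fully conj ZSX.

End Fully.

Definition AutSX P : {set ({ffun gT -> gT} * {perm X})%type} :=
  [set (restr P (conjl s), ell s) | s in 'N_S(P)].

Definition autpairs P (E : {set ({ffun gT -> gT} * {perm X})%type}) :
    {set ({perm gT} * {perm X})%type} :=
  [set u : ({perm gT} * {perm X})%type |
     perm_on P u.1 && ((restr P u.1, u.2) \in E)].

Definition SigmaX XX P : {set {perm X}} :=
  [set sigma | [exists f, (f, sigma) \in XX P P]].
Definition SigmaS P : {set {perm X}} := [set ell s | s in 'N_S(P)].

Definition F0 XX P : {set {ffun gT -> gT}} := [set f | (f, 1) \in XX P P].
Definition FS0 P : {set {ffun gT -> gT}} :=
  [set restr P (conjl s) | s in NSX P].

Definition SigmaX0 XX P : {set {perm X}} :=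
  [set sigma | (incl P, sigma) \in XX P P].
Definition SigmaS0 P : {set {perm X}} := [set ell s | s in 'C_S(P)].

Definition extender P Q u : {set gT} :=
  [set n in 'N_S(P) |
     (fcomp u.1 (fcomp (restr P (conjl n)) (finvl P u.1)), ell n ^ u.2)
       \in AutSX Q].

(** The extender is a group (see [group_set_extender] below), so that
    [<<_>>] only supplies the group structure. *)
Record saturated_fusion_action_system (p : nat) XX : Prop :=
    SaturatedFusionActionSystem {
  sfas_fusion_action_system : fusion_action_system p XX;
  sfas_fully : forall P, P \subset S ->
    [/\ fully_normalized XX P -> fully_X_normalized XX P,
        fully_normalized XX P -> fully_centralized XX P,
        fully_X_normalized XX P -> fully_X_centralized XX P
      & fully_centralized XX P -> fully_X_centralized XX P];
  sfas_normalized : forall P, P \subset S -> fully_normalized XX P ->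
    [/\ p.-Sylow(autperms P (underlying XX P P)) (autperms P (AutS S P)),
        p.-Sylow(autpairs P (XX P P)) (autpairs P (AutSX P))
      & p.-Sylow(SigmaX XX P) (SigmaS P)];
  sfas_X_normalized : forall P, P \subset S -> fully_X_normalized XX P ->
    p.-Sylow(autperms P (F0 XX P)) (autperms P (FS0 P));
  sfas_centralized : forall P, P \subset S -> fully_centralized XX P ->
    p.-Sylow(SigmaX0 XX P) (SigmaS0 P);
  sfas_extension : forall P Q f sigma, P \subset S -> Q \subset S ->
    fully_X_centralized XX Q -> (f, sigma) \in fas_iso XX P Q ->
    exists2 g, (g, sigma) \in XX <<extender P Q (f, sigma)>>%G S
             & restr P g = f
}.

Definition core_fusion XX : hom_family gT := fun P Q =>
  [set f in Inj P Q | (f, 1) \in XX P Q].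

End FusionActionSystems.

Section ExtenderGroups.

Variable gT : finGroupType.
Implicit Types (T P Q : {group gT}) (f : {ffun gT -> gT}).

Lemma fcompE f g x : fcomp g f x = g (f x). Proof. exact: ffunE. Qed.

Lemma restrE (P : {set gT}) (f : gT -> gT) x :
  restr P f x = if x \in P then f x else 1.
Proof. exact: ffunE. Qed.

Lemma InjP P Q f :
  reflect [/\ f = restr P f, {in P &, {morph f : x y / x * y}},
              {in P &, injective f} & {in P, forall x, f x \in Q}]
          (f \in Inj P Q).
Proof.
rewrite inE; apply: (iffP and4P) => [[/eqP fE /morphicP fM /dinjectiveP fI fQ]|].
  by split=> // x Px; apply: (subsetP fQ); apply: imset_f.
case=> fE fM fI fQ; split; first exact/eqP; first exact/morphicP.
  exact/dinjectiveP.
by apply/subsetP=> _ /imsetP[x Px ->]; apply: fQ.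
Qed.

Lemma finvlK P Q f : f \in Inj P Q -> {in P, cancel f (finvl P f)}.
Proof.
case/InjP=> _ _ fI _ x Px; rewrite ffunE; case: pickP => [y /andP[Py /eqP]|].
  exact: fI.
by move/(_ x); rewrite Px eqxx.
Qed.

Lemma finvl1 P Q f y : f \in Inj P Q -> y \notin f @: P -> finvl P f y = 1.
Proof.
move=> _ yP; rewrite ffunE; case: pickP => // x /andP[Px /eqP fx].
by rewrite -fx imset_f in yP.
Qed.

Lemma Inj1 P Q f : f \in Inj P Q -> f 1 = 1.
Proof.
case/InjP=> _ fM _ _; apply: (mulgI (f 1)).
by rewrite -fM ?group1 // !mulg1.
Qed.

(** [f c_n f^-1 = c_t] on [Q = f @: P] iff [f c_n = c_t f] on [P]. *)
Lemma conj_extenderP P Q f n t :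
    f \in Inj P Q -> f @: P = Q -> n \in 'N(P) ->
  (fcomp f (fcomp (restr P (conjl n)) (finvl P f)) = restr Q (conjl t))
  <-> {in P, forall x, f (conjl n x) = conjl t (f x)}.
Proof.
move=> fI fPQ Nn; have f1 := Inj1 fI.
split=> [/ffunP eq_f x Px | eq_f].
  have:= eq_f (f x); rewrite !fcompE !restrE (finvlK fI) // Px => ->.
  by rewrite -fPQ imset_f.
apply/ffunP=> y; rewrite !fcompE !restrE; have [Qy | Qy] := boolP (y \in Q).
  move: Qy; rewrite -{1}fPQ => /imsetP[x Px ->].
  by rewrite -eq_f // !(finvlK fI) // Px.
by rewrite (finvl1 fI) ?fPQ // group1 /conjl mulg1 mulgV f1.
Qed.

Lemma conjlM s t x : conjl (s * t) x = conjl s (conjl t x) :> gT.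
Proof. by rewrite /conjl invMg !mulgA. Qed.

Lemma conjl_in P n x : n \in 'N(P) -> (conjl n x \in P) = (x \in P).
Proof. by move=> Nn; rewrite /conjl -mulgA -{1}(invgK n) -conjgE memJ_norm ?groupV. Qed.

Lemma group_set_fs_extender T P Q f :
  f \in Inj P Q -> f @: P = Q -> group_set (fs_extender T P Q f).
Proof.
move=> fI fPQ.
have extP n : reflect (n \in 'N_T(P) /\ exists2 t, t \in 'N_T(Q) &
    {in P, forall x, f (conjl n x) = conjl t (f x)}) (n \in fs_extender T P Q f).
  rewrite [n \in fs_extender _ _ _ _]in_set; apply: (iffP andP) => [] [NTn].
    have Nn: n \in 'N(P) by case/setIP: NTn.
    by case/imsetP=> t NTt /(conj_extenderP _ fI fPQ Nn); split=> //; exists t.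
  have Nn: n \in 'N(P) by case/setIP: NTn.
  case=> t NTt /(conj_extenderP _ fI fPQ Nn) ->; split=> //.
  exact: imset_f.
apply/group_setP; split.
  apply/extP; split; first exact: group1; exists 1 => [|x Px]; first exact: group1.
  by rewrite /conjl !mul1g !invg1 !mulg1.
move=> m n /extP[Nm [s Ns ms]] /extP[Nn [t Nt nt]]; apply/extP.
split; first exact: groupM; exists (s * t) => [|x Px]; first exact: groupM.
have Nn': n \in 'N(P) by case/setIP: Nn.
by rewrite !conjlM ms ?conjl_in // nt.
Qed.

Lemma group_set_extender (X : finType) (S P Q : {group gT}) (to : action S X)
    (u : {ffun gT -> gT} * {perm X}) :
  u.1 \in Inj P Q -> u.1 @: P = Q -> group_set (extender to P Q u).
Proof.
case: u => f sigma /= fI fPQ.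
have extP n : reflect (n \in 'N_S(P) /\ exists2 t, t \in 'N_S(Q) &
    {in P, forall x, f (conjl n x) = conjl t (f x)}
    /\ ell to n ^ sigma = ell to t) (n \in extender to P Q (f, sigma)).
  rewrite [n \in extender _ _ _ _]in_set; apply: (iffP andP) => [] [NSn].
    have Nn: n \in 'N(P) by case/setIP: NSn.
    case/imsetP=> t NSt [/(conj_extenderP _ fI fPQ Nn) ? ?].
    by split=> //; exists t.
  have Nn: n \in 'N(P) by case/setIP: NSn.
  case=> t NSt [/(conj_extenderP _ fI fPQ Nn) /= -> /= ->]; split=> //.
  exact: imset_f.
apply/group_setP; split.
  apply/extP; split; first exact: group1.
  exists 1 => [|]; first exact: group1.
  by split=> [x Px|]; rewrite ?ell1 ?conj1g // /conjl !mul1g !invg1 !mulg1.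
move=> m n /extP[Nm [s Ns [ms ems]]] /extP[Nn [t Nt [nt ent]]]; apply/extP.
have [[Sm _] [Sn Nn']] := (setIP Nm, setIP Nn).
have [[Ss _] [St _]] := (setIP Ns, setIP Nt).
split; first exact: groupM.
exists (s * t); first exact: groupM; split=> [x Px|].
  by rewrite !conjlM ms ?conjl_in // nt.
by rewrite !ellM // conjMg ems ent.
Qed.

End ExtenderGroups.

Section AutomorphismGroups.

Variables (gT : finGroupType) (P : {group gT}).

Lemma restr1 : restr P (1 : {perm gT}) = incl P.
Proof. by apply/ffunP=> x; rewrite !restrE perm1. Qed.

Lemma restrM (a b : {perm gT}) : perm_on P a ->
    restr P b \in Inj P P ->
  restr P (a * b) = fcomp (restr P b) (restr P a).
Proof.
move=> Pa /Inj1 b1; apply/ffunP=> x; rewrite fcompE [LHS]restrE permM.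
by rewrite (restrE P a); case: ifP => Px; rewrite ?b1 // restrE perm_closed ?Px.
Qed.

Lemma group_set_autperms (E : {set {ffun gT -> gT}}) :
    E \subset Inj P P ->
    incl P \in E -> {in E &, forall f g, fcomp g f \in E} ->
  group_set (autperms P E).
Proof.
move=> EI E1 EM; apply/group_setP; split.
  by rewrite in_set perm_on1 restr1 E1.
move=> a b; rewrite !in_set => /andP[Pa Ea] /andP[Pb Eb].
by rewrite perm_onM // restrM ?EM // (subsetP EI).
Qed.

Lemma group_set_autpairs (X : finType)
    (E : {set ({ffun gT -> gT} * {perm X})%type}) :
    {in E, forall u, u.1 \in Inj P P} -> aincl X P \in E -> {in E &, forall u v, acomp v u \in E} ->
  group_set (autpairs P E).
Proof.
move=> EI E1 EM; apply/group_setP; split.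
  by rewrite in_set perm_on1 restr1.
move=> [a s] [b t]; rewrite !in_set /= => /andP[Pa Ea] /andP[Pb Eb].
by rewrite perm_onM // restrM ?(EI _ Eb) //; apply: EM Ea Eb.
Qed.

End AutomorphismGroups.

(* Main.v *)
Require Import Defs.
From mathcomp Require Import all_boot all_fingroup all_solvable.
Import GroupScope.

(** Write [C] for the core.  Inside [C] the notions relative to the action are
    the ordinary ones for the group [C]: for [P] in [C], the subgroups
    [NSX to P] and [ZSX to P] are the normalizer and centralizer of [P] in [C],
    and the sets in the third saturation axiom are the automorphism groups of
    [P] in the core fusion system and in [C].  The only obstacle is that being
    fully normalized or centralized refers to two different conjugacy relations:
    the action system may conjugate [P] by pairs [(f, sigma)] with
    [sigma <> 1].

    These extra conjugations are harmless ([core_aut_of_perm]).  The trivial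
    subgroup is alone in its conjugacy class, hence fully X-centralized, so the
    extension axiom applies to the restriction [(1, sigma)] of [(f, sigma)] to
    it.  The extender contains every [n] in [C], because
    [ell n ^ sigma = 1 = ell 1]; so [sigma] is the second component of an
    automorphism [(psi, sigma)] of [C].  Therefore [f] is [psi] composed with a
    morphism of the core fusion system, and [psi], an automorphism of the group
    [C], preserves the orders of normalizers and centralizers in [C].
    Consequently the maximality conditions of the core fusion system imply those
    relative to the action ([core_fully_fully_X]); the converse holds since
    conjugate subgroups of the core fusion system are conjugate in the action
    system ([core_conj_conj]).  Saturation of the core is then read off from the
    first, third and fifth saturation axioms. *)

(** * Injective homomorphisms *)

Section InjectiveHomomorphisms.

Context {gT : finGroupType}.
Implicit Types P Q R : {group gT}.

Lemma Inj_image_group {P Q} {f : {ffun gT -> gT}} :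
  f \in Inj P Q -> exists R : {group gT}, f @: P = R.
Proof.
case/InjP=> _ fM _ _; exists (Morphism fM @* P)%G.
by rewrite /= morphimEdom.
Qed.

Lemma Inj_sub_image {P Q} {f : {ffun gT -> gT}} :
  f \in Inj P Q -> f @: P \subset Q.
Proof. by rewrite inE => /and4P[]. Qed.

Lemma Inj_widen {P Q R} {f : {ffun gT -> gT}} :
  f \in Inj P Q -> f @: P \subset R -> f \in Inj P R.
Proof. by rewrite !inE => /and4P[-> -> -> _] ->. Qed.

Lemma Inj_out {P Q} {f : {ffun gT -> gT}} {x} :
  f \in Inj P Q -> x \notin P -> f x = 1.
Proof. by case/InjP=> -> _ _ _ /negbTE Px; rewrite restrE Px. Qed.

Lemma fcomp_incl_l {P Q} {R : {group gT}} {f : {ffun gT -> gT}} :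
  f \in Inj P Q -> f @: P \subset R -> fcomp (incl R) f = f.
Proof.
move=> fI fR; apply/ffunP=> x; rewrite fcompE restrE.
case: (boolP (x \in P)) => [Px | /(Inj_out fI) ->]; last by rewrite group1.
by rewrite (subsetP fR) ?imset_f.
Qed.

Lemma fcomp_incl_r {P Q} (R : {group gT}) {f : {ffun gT -> gT}} :
  f \in Inj P Q -> fcomp f (incl R) = restr R f.
Proof.
move=> fI; apply/ffunP=> x; rewrite fcompE !restrE.
by case: ifP => // _; rewrite (Inj1 fI).
Qed.

Lemma inverse_image {P Q} {f g : {ffun gT -> gT}} :
    f \in Inj P Q -> g \in Inj Q P -> fcomp f g = incl Q ->
  f @: P = Q.
Proof.
move=> fI gI fg; apply/eqP; rewrite eqEsubset (Inj_sub_image fI) /=.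
apply/subsetP=> y Qy; have := congr1 (fun h : {ffun _} => h y) fg.
rewrite fcompE restrE Qy => <-; apply: imset_f.
by apply: (subsetP (Inj_sub_image gI)); apply: imset_f.
Qed.

Lemma Inj_card_norm {C Q} {f : {ffun gT -> gT}} {R : {group gT}} :
    f \in Inj C C -> Q \subset C -> f @: Q = R ->
  #|'N_C(Q)| <= #|'N_C(R)|.
Proof.
case/InjP=> _ fM fI fC QC fQ.
rewrite -(card_in_imset (f := f) (D := mem 'N_C(Q))); last first.
  by move=> x y /setIP[Cx _] /setIP[Cy _]; apply: fI.
pose F := Morphism fM.
have FR : F @* Q = R by rewrite -fQ morphimEsub.
have -> : f @: 'N_C(Q) = F @* 'N_C(Q) by rewrite morphimEsub ?subsetIl.
apply: subset_leq_card; rewrite subsetI; apply/andP; split.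
  by apply/subsetP=> _ /morphimP[x Cx _ ->]; apply: fC.
by rewrite -FR (subset_trans (morphimS _ (subsetIr _ _))) ?morphim_norm.
Qed.

Lemma Inj_card_cent {C Q} {f : {ffun gT -> gT}} {R : {group gT}} :
    f \in Inj C C -> Q \subset C -> f @: Q = R ->
  #|'C_C(Q)| <= #|'C_C(R)|.
Proof.
case/InjP=> _ fM fI fC QC fQ.
rewrite -(card_in_imset (f := f) (D := mem 'C_C(Q))); last first.
  by move=> x y /setIP[Cx _] /setIP[Cy _]; apply: fI.
pose F := Morphism fM.
have FR : F @* Q = R by rewrite -fQ morphimEsub.
have -> : f @: 'C_C(Q) = F @* 'C_C(Q) by rewrite morphimEsub ?subsetIl.
apply: subset_leq_card; rewrite subsetI; apply/andP; split.
  by apply/subsetP=> _ /morphimP[x Cx _ ->]; apply: fC.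
by rewrite -FR (subset_trans (morphimS _ (subsetIr _ _))) ?morphim_cent.
Qed.

End InjectiveHomomorphisms.

(** * The core fusion system of a fusion action system *)

Section CoreFusion.

Context {gT : finGroupType} {p : nat} {S : {group gT}} {X : finType}.
Context {to : action S X} {XX : action_hom_family gT X}.
Hypothesis fasX : fusion_action_system to p XX.
Implicit Types P Q R : {group gT}.

Let C := core to.

Lemma core_sub : C \subset S.
Proof. by apply/subsetP=> x; rewrite inE => /andP[]. Qed.

Lemma ell_core x : x \in C -> ell to x = 1.
Proof. by rewrite inE => /andP[_ /eqP]. Qed.

Lemma NSX_core P : NSX to P = 'N_C(P).
Proof. by rewrite /NSX -setIA setIC -setIA (setIidPl core_sub) setIC. Qed.

Lemma ZSX_core P : ZSX to P = 'C_C(P).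
Proof. by rewrite /ZSX -setIA setIC -setIA (setIidPl core_sub) setIC. Qed.

Lemma fas_Inj {P Q u} :
  P \subset S -> Q \subset S -> u \in XX P Q -> u.1 \in Inj P Q.
Proof.
move=> PS QS uX; case: (fas_sub fasX PS QS) => _ /subsetP/(_ u uX).
by rewrite inE => /andP[].
Qed.

Lemma fas_ell {P Q u x} :
  P \subset S -> Q \subset S -> u \in XX P Q -> x \in P ->
  ell to x ^ u.2 = ell to (u.1 x).
Proof.
move=> PS QS uX Px; case: (fas_sub fasX PS QS) => _ /subsetP/(_ u uX).
by rewrite inE => /andP[_ /forall_inP/(_ x Px)/eqP].
Qed.

Lemma fas_incl {P Q} : P \subset Q -> Q \subset S -> aincl X P \in XX P Q.
Proof.
move=> PQ QS; have PS := subset_trans PQ QS.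
case: (fas_sub fasX PS QS) => /subsetP sXS _; apply: sXS.
apply/imsetP; exists 1; first by rewrite inE group1 invg1 conjsg1.
rewrite ell1 /aincl; congr pair.
by apply/ffunP=> x; rewrite !restrE /conjl mul1g invg1 mulg1.
Qed.

(** Factorization forces a morphism to be an isomorphism onto its image, so that
    the target may be replaced by any subgroup containing that image. *)
Lemma fas_iso_image {P Q R u} :
    P \subset S -> Q \subset S -> u \in XX P Q -> u.1 @: P = R ->
  u \in fas_iso XX P R.
Proof.
move=> PS QS uX uR; have [R' R'Q [v viso def_u]] := fas_factor fasX PS QS uX.
have R'S := subset_trans R'Q QS; have := viso.
rewrite inE => /andP[vX /exists_inP[w wX /andP[_ /eqP[vw _]]]].
have vI := fas_Inj PS R'S vX; have wI := fas_Inj R'S PS wX.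
have vR' := inverse_image vI wI vw.
have uv : u = v.
  by rewrite def_u /acomp /= (fcomp_incl_l vI) ?vR' // mulg1; case: (v).
suff -> : R = R' by rewrite uv.
by apply: val_inj; rewrite /= -uR uv vR'.
Qed.

Lemma fas_widen {P Q R u} :
    P \subset S -> Q \subset S -> R \subset S -> u \in XX P Q ->
  u.1 @: P \subset R -> u \in XX P R.
Proof.
move=> PS QS RS uX uR; have uI := fas_Inj PS QS uX.
have [R' defR'] := Inj_image_group uI; have R'R : R' \subset R by rewrite -defR'.
have := fas_iso_image PS QS uX defR'; rewrite inE => /andP[uX' _].
have R'S := subset_trans R'R RS.
have := fas_comp fasX PS R'S RS uX' (fas_incl R'R RS).
suff -> : acomp (aincl X R') u = u by [].
by rewrite /acomp /= (fcomp_incl_l uI) ?defR' // mulg1; case: (u).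
Qed.

Lemma fas_restr {P Q R f sigma} :
    P \subset R -> R \subset S -> Q \subset S -> (f, sigma) \in XX R Q ->
  (restr P f, sigma) \in XX P Q.
Proof.
move=> PR RS QS uX; have PS := subset_trans PR RS.
have := fas_comp fasX PS RS QS (fas_incl PR RS) uX.
by rewrite /acomp /= mul1g (fcomp_incl_r P (fas_Inj RS QS uX)).
Qed.

(** The core is strongly closed. *)
Lemma fas_core_image {P Q u} :
    P \subset C -> Q \subset S -> u \in XX P Q -> u.1 @: P \subset C.
Proof.
move=> PC QS uX; have PS := subset_trans PC core_sub.
apply/subsetP=> _ /imsetP[x Px ->]; rewrite inE.
rewrite -(fas_ell PS QS uX Px) ell_core ?(subsetP PC) // conj1g eqxx andbT.
by apply: (subsetP QS); apply: (subsetP (Inj_sub_image (fas_Inj PS QS uX)));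
   apply: imset_f.
Qed.

Lemma core_fusionE {P Q f} : P \subset S -> Q \subset S ->
  (f \in core_fusion XX P Q) = ((f, 1) \in XX P Q).
Proof.
by move=> PS QS; rewrite inE; apply: andb_idl => /(fas_Inj PS QS).
Qed.

Lemma core_isoE {P Q f} : P \subset S -> Q \subset S ->
  (f \in fs_iso (core_fusion XX) P Q) = ((f, 1) \in fas_iso XX P Q).
Proof.
move=> PS QS; rewrite [LHS]in_set [RHS]in_set core_fusionE //; congr (_ && _).
apply/exists_inP/exists_inP => [[g]|[[g tau] gX]].
  rewrite core_fusionE // => gX /andP[/eqP gf /eqP fg].
  by exists (g, 1); rewrite // /acomp /= gf fg mulg1 !eqxx.
case/andP=> /eqP[gf]; rewrite mul1g => tau1 /eqP[fg _].
by exists g; rewrite ?core_fusionE ?gf ?fg ?eqxx // -tau1.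
Qed.

Lemma core_conj_conj {P Q} :
  fs_conj C (core_fusion XX) P Q -> fs_conj S (underlying XX) P Q.
Proof.
case=> PC QC /set0Pn[f]; rewrite inE => /andP[fX /exists_inP[g gX gf]].
have [PS QS] := (subset_trans PC core_sub, subset_trans QC core_sub).
rewrite !core_fusionE // in fX gX; split=> //.
apply/set0Pn; exists f; rewrite inE; apply/andP; split.
  by rewrite inE; apply/existsP; exists 1.
apply/exists_inP; exists g => //; rewrite inE.
by apply/existsP; exists 1.
Qed.

Lemma core_fusion_system : fusion_system p C (core_fusion XX).
Proof.
have CS := core_sub; split=> [|P Q _ _|P Q t PC QC tC PQ||P Q f PC QC].
- exact: pgroupS core_sub (fas_pgroup fasX).
- by apply/subsetP=> f; rewrite inE => /andP[].
- have [PS QS] := (subset_trans PC CS, subset_trans QC CS).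
  rewrite core_fusionE //; case: (fas_sub fasX PS QS) => /subsetP sXS _.
  apply: sXS; apply/imsetP; exists t; last by rewrite ell_core.
  by rewrite inE (subsetP CS).
- move=> P Q R f g PC QC RC.
  have PS := subset_trans PC CS; have QS := subset_trans QC CS.
  have RS := subset_trans RC CS; rewrite !core_fusionE // => fX gX.
  by have := fas_comp fasX PS QS RS fX gX; rewrite /acomp /= mulg1.
have [PS QS] := (subset_trans PC CS, subset_trans QC CS).
rewrite core_fusionE // => fX; have fI := fas_Inj PS QS fX.
have [R defR] := Inj_image_group fI.
have RQ : R \subset Q by rewrite -defR (Inj_sub_image fI).
exists R => //; exists f; last by rewrite (fcomp_incl_l fI) ?defR.
by rewrite core_isoE ?(subset_trans RQ) // (fas_iso_image PS QS fX).
Qed.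

End CoreFusion.

(** * Saturation of the core *)

Section CoreSaturation.

Context {gT : finGroupType} {p : nat} {S : {group gT}} {X : finType}.
Context {to : action S X} {XX : action_hom_family gT X}.
Hypothesis satX : saturated_fusion_action_system to p XX.
Implicit Types P Q R : {group gT}.

Let C := core to.
Let fasX := sfas_fusion_action_system satX.

Lemma fully_X_centralized1 : fully_X_centralized to XX 1%G.
Proof.
move=> Q [_ QS /set0Pn[f]]; rewrite inE => /andP[].
rewrite inE => /existsP[sigma fX] /exists_inP[g].
rewrite inE => /existsP[tau gX] /andP[_ /eqP fg].
have fI := fas_Inj fasX (sub1G S) QS fX.
have gI := fas_Inj fasX QS (sub1G S) gX.
have /= Q1 := inverse_image fI gI fg.
suff -> : Q = 1%G by [].
by apply: val_inj; rewrite /= -Q1 imset_set1 (Inj1 fI).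
Qed.

(** The extension axiom for the restriction of [u] to the trivial subgroup:
    elements of the core act trivially, so they all lie in the extender. *)
Lemma core_aut_of_perm {P Q u} :
    P \subset S -> Q \subset S -> u \in XX P Q ->
  exists psi, (psi, u.2) \in fas_iso XX C C.
Proof.
case: u => f sigma PS QS uX /=; have CS := core_sub : C \subset S.
have uX1 := fas_restr fasX (sub1G P) PS QS uX.
have rI := fas_Inj fasX (sub1G S) QS uX1.
have r1 : restr 1%G f @: 1%G = 1%G by rewrite imset_set1 (Inj1 rI).
have uiso := fas_iso_image fasX (sub1G S) QS uX1 r1.
have [g gX _] :=
  sfas_extension satX (sub1G S) (sub1G S) fully_X_centralized1 uiso.
set N := <<_>>%G in gX.
have NS : N \subset S by rewrite gen_subG; apply/subsetP=> x /setIdP[/setIP[]].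
have CN : C \subset N.
  apply: sub_gen; apply/subsetP=> x Cx; rewrite inE in_setI norm1 inE andbT.
  rewrite (subsetP CS) //=; apply/imsetP; exists 1; first exact: group1.
  rewrite (ell_core x Cx) conj1g ell1; congr pair.
  have rI1 : restr 1%G f \in Inj 1%G 1%G by apply: (Inj_widen rI); rewrite r1.
  have Nx : x \in 'N(1%G : {set gT}) by rewrite norm1 inE.
  apply/(conj_extenderP 1 rI1 r1 Nx) => y /set1P->.
  by rewrite /conjl mulg1 mulgV (Inj1 rI1) mulg1 mulgV.
have hX := fas_restr fasX CN NS (subxx _) gX.
have hC := fas_core_image fasX (subxx C) (subxx S) hX.
exists (restr C g); apply: (fas_iso_image fasX CS (subxx S) hX).
apply/eqP; rewrite eqEcard hC card_in_imset ?leqnn //.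
by case/InjP: (fas_Inj fasX CS (subxx S) hX).
Qed.

(** A conjugation of [P] in the action system is one in the core fusion system
    up to an automorphism of the core, and [grow] says that such an automorphism
    does not decrease the order of [N]. *)
Lemma core_fully_fully_X (N : {group gT} -> {set gT}) P :
    (forall f Q R, f \in Inj C C -> Q \subset C -> f @: Q = R ->
       #|N Q| <= #|N R|) ->
    P \subset C -> fully (fs_conj C (core_fusion XX)) N P ->
  fully (fs_conj S (underlying XX)) N P.
Proof.
move=> grow PC fullP Q [PS QS /set0Pn[f]]; rewrite inE => /andP[].
rewrite inE => /existsP[sigma fX] /exists_inP[g].
rewrite inE => /existsP[tau gX] /andP[_ /eqP fg].
have CS := core_sub : C \subset S.
have fI := fas_Inj fasX PS QS fX; have gI := fas_Inj fasX QS PS gX.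
have /= fP := inverse_image fI gI fg.
have QC : Q \subset C by rewrite -fP; apply: (fas_core_image fasX PC QS fX).
have [psi] := core_aut_of_perm PS QS fX.
rewrite inE => /andP[_ /exists_inP[[w rho] wX /andP[_ /eqP[_ /= rho_sigma]]]].
have wI := fas_Inj fasX CS CS wX.
have fXC : (f, sigma) \in XX P C by apply: (fas_widen fasX PS QS CS fX); rewrite fP.
have hX := fas_comp fasX PS CS CS fXC wX.
have hI := fas_Inj fasX PS CS hX; have [R defR] := Inj_image_group hI.
have RC : R \subset C by rewrite -defR (Inj_sub_image hI).
have wQ : w @: Q = R.
  by rewrite -fP -defR -imset_comp; apply: eq_imset => x; rewrite /= fcompE.
apply: leq_trans (grow _ _ _ wI QC wQ) _; apply: fullP; split=> //.
have RS := subset_trans RC CS.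
apply/set0Pn; exists (fcomp w f); rewrite (core_isoE fasX) //.
have := fas_iso_image fasX PS CS hX defR; rewrite /acomp /=.
suff -> : sigma * rho = 1 by [].
by apply: (mulgI rho); rewrite mulgA rho_sigma mul1g mulg1.
Qed.

Lemma core_fully_X_normalized P :
    P \subset C -> fs_fully_normalized C (core_fusion XX) P ->
  fully_X_normalized to XX P.
Proof.
move=> PC nP Q PQ; rewrite !NSX_core.
apply: (core_fully_fully_X (fun R => 'N_C(R)) P _ PC nP Q PQ).
by move=> f Q' R; apply: Inj_card_norm.
Qed.

Lemma core_fully_X_centralized P :
    P \subset C -> fs_fully_centralized C (core_fusion XX) P ->
  fully_X_centralized to XX P.
Proof.
move=> PC cP Q PQ; rewrite !ZSX_core.
apply: (core_fully_fully_X (fun R => 'C_C(R)) P _ PC cP Q PQ).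
by move=> f Q' R; apply: Inj_card_cent.
Qed.

Lemma fully_X_centralized_core P :
    fully_X_centralized to XX P ->
  fs_fully_centralized C (core_fusion XX) P.
Proof.
move=> cP Q /(core_conj_conj fasX)/cP.
by rewrite !ZSX_core.
Qed.

Lemma core_sylow P :
    P \subset C -> fully_X_normalized to XX P ->
  p.-Sylow(autperms P (core_fusion XX P P)) (autperms P (AutS C P)).
Proof.
move=> PC nP; have PS := subset_trans PC core_sub.
have := sfas_X_normalized satX PS nP.
have -> : Defs.F0 XX P = core_fusion XX P P.
  by apply/setP=> f; rewrite (core_fusionE fasX) // inE.
by rewrite /FS0 NSX_core.
Qed.

Lemma core_extender_sub {P Q} (f : {ffun gT -> gT}) :
  fs_extender C P Q f \subset extender to P Q (f, 1).
Proof.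
have CS := core_sub : C \subset S.
apply/subsetP=> n; case/setIdP=> /setIP[Cn Nn] /imsetP[t].
case/setIP=> Ct Nt eq_f; rewrite inE in_setI (subsetP CS) // Nn /=.
apply/imsetP; exists t; first by rewrite inE (subsetP CS).
by rewrite eq_f (ell_core n Cn) (ell_core t Ct) conj1g.
Qed.

(** The extension over the larger extender in [S] has second component [1], so
    its restriction to the extender in [C] is a morphism of the core fusion
    system; its image stays in [C] because the core is strongly closed. *)
Lemma core_extension P Q f :
    P \subset C -> Q \subset C -> fully_X_centralized to XX Q ->
    f \in fs_iso (core_fusion XX) P Q ->
  exists2 g, g \in core_fusion XX <<fs_extender C P Q f>>%G C & restr P g = f.
Proof.
move=> PC QC cQ fiso; have CS := core_sub : C \subset S.
have [PS QS] := (subset_trans PC CS, subset_trans QC CS).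
have fI : f \in Inj P Q.
  by move: fiso; rewrite !inE => /andP[/andP[]].
have fQ : f @: P = Q.
  move: fiso; rewrite inE => /andP[_ /exists_inP[g]].
  by rewrite inE => /andP[gI _] /andP[_ /eqP]; apply: inverse_image.
rewrite (core_isoE fasX) // in fiso.
have [g gX gf] := sfas_extension satX PS QS cQ fiso.
set M := <<extender _ _ _ _>>%G in gX; set N := <<fs_extender _ _ _ _>>%G.
have MS : M \subset S by rewrite gen_subG; apply/subsetP=> x /setIdP[/setIP[]].
have NC : N \subset C by rewrite gen_subG; apply/subsetP=> x /setIdP[/setIP[]].
have NM : N \subset M := genS (core_extender_sub f).
have hX := fas_restr fasX NM MS (subxx _) gX.
have hC := fas_core_image fasX NC (subxx S) hX.
have NS := subset_trans NC CS.
exists (restr N g).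
  by rewrite (core_fusionE fasX) // (fas_widen fasX NS (subxx S) CS hX).
(* Conjugation by [x] in [P] is carried by [f] to conjugation by [f x]. *)
have PN : P \subset N.
  apply: sub_gen; apply/subsetP=> x Px.
  have NPx : x \in 'N(P) := subsetP (normG P) x Px.
  rewrite inE in_setI (subsetP PC) // NPx /=.
  have fxQ : f x \in Q by rewrite -fQ imset_f.
  apply/imsetP; exists (f x).
    by rewrite inE (subsetP QC) // (subsetP (normG Q)).
  apply/(conj_extenderP (f x) fI fQ NPx) => y Py.
  case/InjP: (fI) => _ fM _ _; rewrite /conjl !fM ?groupM ?groupV //.
  congr (_ * _); apply: (mulgI (f x)).
  by rewrite -fM ?groupV // !mulgV (Inj1 fI).
rewrite -[RHS]gf; apply/ffunP=> x; rewrite !restrE.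
by case: ifP => // Px; rewrite (subsetP PN).
Qed.

End CoreSaturation.

Theorem theorem2p4p5 (gT : finGroupType) (p : nat) (S : {group gT})
    (X : finType) (to : action S X) (XX : action_hom_family gT X) :
  prime p ->
  saturated_fusion_action_system to p XX ->
  saturated_fusion_system p (core to) (core_fusion XX).
Proof.
move=> _ satX; have fasX := sfas_fusion_action_system satX.
split=> [|P PC nP|P Q f PC QC cQ fiso].
- exact: core_fusion_system fasX.
- have nXP := core_fully_X_normalized satX P PC nP; split.
    have [_ _ cXP _] := sfas_fully satX (subset_trans PC core_sub).
    exact: fully_X_centralized_core satX P (cXP nXP).
  exact: core_sylow satX P PC nXP.
exact: core_extension satX P Q f PC QC (core_fully_X_centralized satX Q QC cQ) fiso.
Qed.
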